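(* Let $w\in FW^*$ be a non-degenerate Farey word, let $m_0:=|w|_0$ and $m_1:=|w|_1$, and let $J_w$ be the corresponding qumterval. For each parameter $\alpha\in J_w$ we have $$K_\alpha^{m_0+1}(\alpha-1)=K_\alpha^{m_1+1}(\alpha).$$
   Context: Farey words. Let $F_0=(0,1)$ be the list of the two one-letter binary words; the list $F_{n+1}$ is obtained from $F_n$ by inserting between every two consecutive words $v,w$ of $F_n$ the concatenation $vw$. Put $FW=\bigcup_{n\ge0}F_n$ and $FW^*=FW\setminus\{0,1\}$. $|w|_0$ and $|w|_1$ are the numbers of digits $0$ and $1$ in $w$. Qumtervals. For a binary word $w$, $RL(w)$ is the string of positive integers recording the lengths of its successive maximal blocks of equal digits. For $w\in FW^*$ with $S=RL(w)$, the qumterval of label $w$ is $J_w=(\alpha^-,\alpha^+)$ where $\alpha^+=[0;\overline{S}]$ and $\alpha^-=1-[0;\overline{{}^tS}]$; here ${}^tS$ is the string $S$ reversed and $[0;\overline{S}]$ is the number whose regular continued fraction has partial quotients given by infinite repetition of $S$. Maps. For $\alpha\in(0,1)$ let $K_\alpha:[\alpha-1,\alpha]\to[\alpha-1,\alpha]$ be defined by $K_\alpha(0)=0$ and $K_\alpha(x)=-\frac1x-c_\alpha(x)$ for $x\ne0$, with $c_\alpha(x)=\lfloor-\frac1x+1-\alpha\rfloor$ (so that $K_\alpha(x)\in[\alpha-1,\alpha)$). *)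

(* Defs.v *)
From mathcomp Require Import all_boot all_order all_algebra.
From mathcomp Require Import all_classical all_reals all_analysis.

Set Implicit Arguments.
Unset Strict Implicit.
Unset Printing Implicit Defensive.

Import Order.TTheory GRing.Theory Num.Theory.
Import numFieldNormedType.Exports.

Local Open Scope classical_set_scope.
Local Open Scope ring_scope.

(* Binary words: the digit 0 is [false], the digit 1 is [true]. *)
Definition word := seq bool.

Fixpoint farey_insert (l : seq word) : seq word :=
  match l with
  | v :: ((w :: _) as l') => v :: (v ++ w) :: farey_insert l'
  | _ => l
  end.

Definition farey_list (n : nat) : seq word :=
  iter n farey_insert [:: [:: false]; [:: true]].

Definition farey_word (w : word) : Prop := exists n, w \in farey_list n.

Definition nondegenerate_farey_word (w : word) : Prop :=
  [/\ farey_word w, w != [:: false] & w != [:: true]].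

Definition num0 (w : word) : nat := count_mem false w.
Definition num1 (w : word) : nat := count_mem true w.

(* Lengths of the successive maximal blocks of equal digits. *)
Fixpoint RL (w : word) : seq nat :=
  match w with
  | [::] => [::]
  | b :: w' =>
    match RL w' with
    | [::] => [:: 1%N]
    | k :: ks => if ohead w' == Some b then k.+1 :: ks else 1%N :: k :: ks
    end
  end.

Section Qumterval.
Variable R : realType.

(* [0; a_1, ..., a_n] *)
Definition fin_cfrac (s : seq nat) : R :=
  foldr (fun a x => (a%:R + x)^-1) 0 s.

(* [0; a 0, a 1, ...], the limit of the convergents. *)
Definition cfrac (a : nat -> nat) : R :=
  lim (fin_cfrac (mkseq a n) @[n --> \oo]).

(* [0; S, S, S, ...] *)
Definition periodic_cfrac (S : seq nat) : R :=
  cfrac (fun i => nth 0%N S (i %% size S)).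

Definition qumterval (w : word) : interval R :=
  `]1 - periodic_cfrac (rev (RL w)), periodic_cfrac (RL w)[.

Definition c_coef (alpha x : R) : int := Num.floor (- x^-1 + 1 - alpha).

(* K_alpha, given by its formula on all of R; for every x the value lies in
   [alpha - 1, alpha] when 0 < alpha < 1, so orbits starting in this segment
   are those of the self-map of the segment. *)
Definition K (alpha x : R) : R :=
  if x == 0 then 0 else - x^-1 - (c_coef alpha x)%:~R.

End Qumterval.

(* Main.v *)
Require Import Defs.
From mathcomp Require Import all_boot all_order all_algebra.
From mathcomp Require Import all_classical all_reals all_analysis.
From mathcomp Require Import ring lra.

Set Implicit Arguments.
Unset Strict Implicit.
Unset Printing Implicit Defensive.

Import Order.TTheory GRing.Theory Num.Theory.
Import numFieldNormedType.Exports.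

Local Open Scope ring_scope.

(** Write a for the parameter.  Let g_0(t) = t/(1+t) and g_1(t) = t+1, the inverse
    branches of the slow continued fraction map, and let g_w be their
    composition along the word w.  The block lengths of w are the partial
    quotients produced by g_w, so the right end of the qumterval of w is the
    positive fixed point of g_w; as reading w backwards with the digits
    exchanged reverses the block lengths, one minus the left end is the fixed
    point of g_w', where w' is the reverse complement of w.  Thus every a in the
    qumterval satisfies a < g_w(a) and 1 - a < g_w'(1 - a) (qumterval_pair).

    Modulo 1 the two slow branches are the identity and, in the coordinate
    x = t - 1, the map -1/x.  Hence, if the slow itinerary of a starts with w and
    the intermediate points are in the right interval, the K-orbit of a - 1
    makes one step for each digit 0 of w and ends at the point x with g_w(x) = a
    (branches_orbit).  The interval condition amounts to g_p(a) < a for every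
    proper nonempty prefix p of w.  If w = u v with u, v neighbours in a Farey
    list, an induction along the tree of such pairs derives it from g_u(a) < a
    and a < g_w(a) (inv_branches_prefix_lt).

    It remains to see that g_u(a) < a.  The matrices of Farey words become
    symmetric when multiplied by the matrix of t |-> 1 - t; this is the
    palindromic structure of Farey words, and it propagates along the tree by
    Cayley-Hamilton (farey_pair_symmetric).  As the matrix of w' is the transpose
    of that of w, applying it to u and u w gives
    g_w'(1 - g_u(t)) = 1 - g_u(g_w(t)), which shows that the left end of the
    qumterval is g_u of the right end, and in particular g_u(a) < a
    (inv_branches_left_lt).

    Finally, the same result for 1 - a and w' describes the orbit of a: after one
    step for each digit 1 it reaches a point y.  The symmetry of the matrix of w
    gives y = x / (1 + x), so -1/x and -1/y differ by 1 (or x = y = 0) and the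
    next step of K identifies them (matching). *)

(** * Pairs of neighbouring Farey words *)

(** Neighbours in some list F_n.  Every Farey word but 0 and 1 is the
    concatenation of such a pair, and all inductions below run along the binary
    tree of these pairs. *)
Inductive farey_pair : word -> word -> Prop :=
| farey_pair_root : farey_pair [:: false] [:: true]
| farey_pair_left v w : farey_pair v w -> farey_pair v (v ++ w)
| farey_pair_right v w : farey_pair v w -> farey_pair (v ++ w) w.

Fixpoint adjacent_pairs (l : seq word) : Prop :=
  if l is v :: ((w :: _) as l') then farey_pair v w /\ adjacent_pairs l'
  else True.

Lemma farey_insert_adjacent l :
  adjacent_pairs l -> adjacent_pairs (farey_insert l).
Proof.
elim: l => [|v [|w l] IH] //= [vw /IH]; case: l {IH} => [|x l] /= IH.
  by do !split=> //; [exact: farey_pair_left|exact: farey_pair_right].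
by do !split=> //; [exact: farey_pair_left|exact: farey_pair_right|
  case: IH..].
Qed.

Lemma mem_farey_insert l x : adjacent_pairs l -> x \in farey_insert l ->
  x \in l \/ exists v w, farey_pair v w /\ x = v ++ w.
Proof.
elim: l => [|v [|w l] IH]; [by left|by left|].
move=> [vw adj].
rewrite [farey_insert _]/= !inE => /or3P[/eqP->|/eqP->|/(IH adj)[]].
- by left; rewrite eqxx.
- by right; exists v, w.
- by rewrite inE => ->; left; rewrite orbT.
- by right.
Qed.

Lemma nondegenerate_farey_pair w : nondegenerate_farey_word w ->
  exists u v, farey_pair u v /\ w = u ++ v.
Proof.
case=> [[n wn] w0 w1].
have adj k : adjacent_pairs (farey_list k).
  elim: k => [|k IH]; first by split=> //; exact: farey_pair_root.
  exact: farey_insert_adjacent.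
elim: n wn => [|n IH].
  by rewrite !inE (negbTE w0) (negbTE w1).
by move=> /(mem_farey_insert (adj n))[/IH|].
Qed.

(** The symmetry of the problem: exchanging the roles of alpha and 1 - alpha
    replaces w by its reverse complement. *)
Definition revcompl (w : word) : word := rev (map negb w).

Lemma revcompl_cat v w : revcompl (v ++ w) = revcompl w ++ revcompl v.
Proof. by rewrite /revcompl map_cat rev_cat. Qed.

Lemma revcomplK : involutive revcompl.
Proof.
by move=> w; rewrite /revcompl map_rev revK -map_comp map_id_in // => b _ /=;
  rewrite negbK.
Qed.

Lemma num0_revcompl w : num0 (revcompl w) = num1 w.
Proof.
rewrite /num0 /num1 /revcompl count_rev count_map; apply: eq_count => b /=.
by case: b.
Qed.

Lemma farey_pair_revcompl v w :
  farey_pair v w -> farey_pair (revcompl w) (revcompl v).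
Proof.
elim=> {v w} [|v w _ IH|v w _ IH]; rewrite ?revcompl_cat.
- exact: farey_pair_root.
- exact: farey_pair_right.
- exact: farey_pair_left.
Qed.

Lemma farey_pair_head v w : farey_pair v w -> exists u, v = false :: u.
Proof.
elim=> {v w} [|//|v w _ [u ->]]; first by exists [::].
by exists (u ++ w).
Qed.

Lemma farey_pair_last v w : farey_pair v w -> exists u, w = rcons u true.
Proof.
move=> /farey_pair_revcompl/farey_pair_head[u hw]; exists (revcompl u).
by rewrite -(revcomplK w) hw /revcompl /= rev_cons.
Qed.

(** * The slow continued fraction map *)

Section Slow.
Variable R : realType.
Implicit Types (t x y a : R) (b : bool) (w : word).

(** The map t/(1-t) on (0,1), t-1 on (1,oo) lowers the first partial quotient of
    1/t or of t by one.  Its two branches carry the letters 0 and 1, so that a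
    word w is a composition of branches, and the number with periodic itinerary
    www... is the positive fixed point of the inverse composition. *)
Definition inv_branch b t : R := if b then t + 1 else t / (1 + t).
Definition branch b t : R := if b then t - 1 else t / (1 - t).
Definition inv_branches w t : R := foldr inv_branch t w.
Definition branches w t : R := foldl (fun s b => branch b s) t w.

Lemma inv_branches_cat v w t :
  inv_branches (v ++ w) t = inv_branches v (inv_branches w t).
Proof. exact: foldr_cat. Qed.

Lemma inv_branch_gt0 b t : 0 < t -> 0 < inv_branch b t.
Proof.
move=> t0; case: b => /=; first by rewrite addr_gt0.
by rewrite divr_gt0 // addr_gt0.
Qed.

Lemma inv_branches_gt0 w t : 0 < t -> 0 < inv_branches w t.
Proof. by move=> t0; elim: w => //= b w; exact: inv_branch_gt0. Qed.

Lemma inv_branch0_lt1 t : 0 < t -> inv_branch false t < 1.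
Proof. by move=> t0 /=; rewrite ltr_pdivrMr ?mul1r; lra. Qed.

Lemma ltr_inv_branch b s t : 0 < s -> 0 < t ->
  (inv_branch b s < inv_branch b t) = (s < t).
Proof.
move=> s0 t0; case: b => /=; first by rewrite ltrD2r.
rewrite ltr_pdivrMr; last lra.
rewrite mulrAC ltr_pdivlMr; last lra.
by apply/idP/idP; nra.
Qed.

Lemma ltr_inv_branches w s t : 0 < s -> 0 < t ->
  (inv_branches w s < inv_branches w t) = (s < t).
Proof.
move=> s0 t0; elim: w => //= b w IH.
by rewrite ltr_inv_branch ?inv_branches_gt0.
Qed.

Lemma ler_inv_branches w s t : 0 < s -> 0 < t ->
  (inv_branches w s <= inv_branches w t) = (s <= t).
Proof. by move=> s0 t0; rewrite !leNgt ltr_inv_branches. Qed.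

(** Each inverse branch g has g(t)/t strictly decreasing, and this survives
    composition.  So for a nonempty word the sign of g(t) - t tells on which side
    of the positive fixed point t lies. *)
Lemma inv_branches_sublinear w s t : w != [::] -> 0 < s -> s < t ->
  inv_branches w t * s < inv_branches w s * t.
Proof.
move=> + s0 st; have t0 := lt_trans s0 st.
have step b w' : inv_branches w' t * s <= inv_branches w' s * t ->
    inv_branches (b :: w') t * s < inv_branches (b :: w') s * t.
  have : inv_branches w' s < inv_branches w' t by rewrite ltr_inv_branches.
  have := inv_branches_gt0 w' s0; rewrite /=.
  move: (inv_branches w' s) (inv_branches w' t) => X Y X0 XY YX.
  case: b => /=; first lra.
  rewrite mulrAC [X in _ < X]mulrAC ltr_pdivrMr; last lra.
  rewrite [X in _ < X]mulrAC ltr_pdivlMr; last lra.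
  apply: lt_le_trans (ler_wpM2r _ YX); last lra.
  by rewrite ltr_pM2l; [lra|rewrite mulr_gt0 // (lt_trans X0)].
elim: w => //= b w IH _; apply: step.
case: w IH => [|c w] IH; first by rewrite /= mulrC.
by apply: ltW; exact: IH.
Qed.

Lemma inv_branches_fixed_gt w a f : w != [::] -> 0 < a -> a < f ->
  inv_branches w f = f -> a < inv_branches w a.
Proof.
move=> w0 a0 af wf; have := inv_branches_sublinear w0 a0 af.
by rewrite wf mulrC ltr_pM2r // (lt_trans a0).
Qed.

Lemma inv_branches_above_below w s t : 0 < s -> 0 < t ->
  s < inv_branches w s -> inv_branches w t < t -> s < t.
Proof.
move=> s0 t0 ws wt; rewrite ltNge; apply/negP => ts.
have w0 : w != [::] by case: w ws {wt} => //=; rewrite ltxx.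
move: ts; rewrite le_eqVlt => /predU1P[e|ts]; first by move: wt; rewrite e; lra.
have := inv_branches_sublinear w0 t0 ts; nra.
Qed.

(** By induction along the tree of pairs.  The two hypotheses pass from a pair
    to its parent, because g_v g_w a is on the same side of a as g_v a and g_w a
    when these are on the same side; and the prefixes of v w are the proper
    prefixes of v, then v itself, then v p with p a prefix of w, where
    g_v g_p a < g_v a < a. *)
Lemma inv_branches_prefix_lt v w a : farey_pair v w -> 0 < a ->
  inv_branches v a < a -> a < inv_branches w a ->
  (forall k, (0 < k < size v)%N -> inv_branches (take k v) a < a) /\
  (forall k, (0 < k < size w)%N -> inv_branches (take k w) a < a).
Proof.
move=> vw a0.
have glue v' w' : inv_branches v' a < a ->
    (forall k, (0 < k < size v')%N -> inv_branches (take k v') a < a) ->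
    (forall k, (0 < k < size w')%N -> inv_branches (take k w') a < a) ->
    forall k, (0 < k < size (v' ++ w'))%N ->
      inv_branches (take k (v' ++ w')) a < a.
  move=> va Pv Pw k /andP[k0 kvw]; rewrite take_cat.
  case: ltnP => kv; first by apply: Pv; rewrite k0.
  rewrite inv_branches_cat; case: (posnP (k - size v')) => [->|k1].
    by rewrite take0.
  apply: lt_trans va; rewrite ltr_inv_branches ?inv_branches_gt0 //.
  by apply: Pw; rewrite k1 ltn_subLR // -size_cat.
elim: vw => {v w} [_ _|v w _ IH va|v w _ IH].
- by split=> -[|[|k]].
- rewrite inv_branches_cat => avw.
  have aw : a < inv_branches w a.
    rewrite ltNge; apply/negP => wa; move: avw; apply/negP; rewrite -leNgt.
    by rewrite (le_trans _ (ltW va)) // ler_inv_branches ?inv_branches_gt0.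
  have [Pv Pw] := IH va aw.
  by split=> //; exact: glue.
- rewrite inv_branches_cat => vwa aw.
  have va : inv_branches v a < a.
    apply: le_lt_trans vwa.
    by rewrite ler_inv_branches ?inv_branches_gt0 // ltW.
  have [Pv Pw] := IH va aw.
  by split=> //; exact: glue.
Qed.

(** * Matrices of Farey words *)

(** The unipotent matrices of t/(1+t) and t+1; they are transposes of one
    another. *)
Definition letter_mx b : 'M[R]_2 :=
  \matrix_(i < 2, j < 2) ((i == j) || (if b then i < j else j < i)%N)%:R.

Definition word_mx w : 'M[R]_2 := foldr (fun b A => letter_mx b *m A) 1%:M w.

(** The action y = (A x) written without division, since the points at which
    it is used need not be positive. *)
Definition mobius (A : 'M[R]_2) x y : Prop :=
  y * (A 1 0 * x + A 1 1) = A 0 0 * x + A 0 1.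

Lemma ord2P (i : 'I_2) : i = 0 \/ i = 1.
Proof. by case: i => [[|[|]]] // h; [left|right]; apply: val_inj. Qed.

Lemma mulmx2E (A B : 'M[R]_2) i j :
  (A *m B) i j = A i 0 * B 0 j + A i 1 * B 1 j.
Proof.
rewrite mxE !big_ord_recl big_ord0 addr0.
by have -> : lift ord0 ord0 = 1 :> 'I_2 by exact: val_inj.
Qed.

Lemma mx2P (A B : 'M[R]_2) : A 0 0 = B 0 0 -> A 0 1 = B 0 1 ->
  A 1 0 = B 1 0 -> A 1 1 = B 1 1 -> A = B.
Proof.
move=> e00 e01 e10 e11; apply/matrixP => i j.
by case: (ord2P i) (ord2P j) => -> [] ->.
Qed.

Lemma word_mx_cat v w : word_mx (v ++ w) = word_mx v *m word_mx w.
Proof. by elim: v => [|b v IH] /=; rewrite ?mul1mx // IH mulmxA. Qed.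

(** Reversal and transposition both reverse products, and transposition swaps
    the two generators, as complementation does. *)
Lemma word_mx_revcompl w : word_mx (revcompl w) = (word_mx w)^T.
Proof.
elim: w => [|b w IH] /=; first by rewrite trmx1.
rewrite -cat1s revcompl_cat word_mx_cat IH trmx_mul; congr (_ *m _).
rewrite /= mulmx1; apply: mx2P; rewrite !mxE /=; by case: b.
Qed.

Lemma det2E (A : 'M[R]_2) : \det A = A 0 0 * A 1 1 - A 0 1 * A 1 0.
Proof.
rewrite (expand_det_row _ 0) !big_ord_recl big_ord0 addr0 /cofactor !det_mx11.
have l1 : lift ord0 ord0 = 1 :> 'I_2 by exact: val_inj.
have l0 : lift 1 ord0 = 0 :> 'I_2 by exact: val_inj.
by rewrite !mxE /= !l1 !l0 /=; ring.
Qed.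

Lemma det_word_mx w : \det (word_mx w) = 1.
Proof.
elim: w => [|b w IH] /=; first by rewrite det1.
rewrite det_mulmx IH mulr1 det2E !mxE /=; case: b => /=; ring.
Qed.

Lemma mobius_cons b A x t : (b = false -> 1 + t != 0) ->
  mobius A x t -> mobius (letter_mx b *m A) x (inv_branch b t).
Proof.
rewrite /mobius !mulmx2E !mxE; case: b => /= h e; first by nra.
have {}h := h erefl; apply: (mulfI h); rewrite mulrA.
rewrite [_ * (t / _)]mulrC divfK //.
nra.
Qed.

Lemma inv_branchesE w t : 0 < t ->
  let A := word_mx w in
  [/\ 0 < A 0 0 * t + A 0 1, 0 < A 1 0 * t + A 1 1
    & inv_branches w t = (A 0 0 * t + A 0 1) / (A 1 0 * t + A 1 1)].
Proof.
move=> t0 /=; elim: w => [|b w [n0 d0 e]] /=.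
  by rewrite !mxE /= mul1r mul0r addr0 add0r divr1.
rewrite !mulmx2E !mxE e; case: b => /=; rewrite ?mul1r ?mul0r ?add0r ?addr0.
  by split; [lra|lra|field; lra].
by split; [lra|lra|field; lra].
Qed.

(** The matrix of the reflection t |-> 1 - t. *)
Definition rho : 'M[R]_2 :=
  \matrix_(i < 2, j < 2) (if j == 0 then if i == 0 then -1 else 0 else 1).

(** Nondegenerate Farey words have the form 0u1 with u a palindrome.  Reversing
    u exchanges the diagonal entries of its matrix, so these are equal; for the
    matrix of 0u1 this is the linear condition below. *)
Definition rho_symmetric (A : 'M[R]_2) : Prop := (rho *m A)^T = rho *m A.

Lemma rho_symmetricP (A : 'M[R]_2) :
  rho_symmetric A <-> A 1 1 = A 0 1 + A 1 0.
Proof.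
split=> [/matrixP/(_ 0 1)|e].
  rewrite mxE !mulmx2E !mxE /=; lra.
apply: mx2P; rewrite ?[_^T _ _]mxE !mulmx2E !mxE /=; lra.
Qed.

Lemma Cayley_Hamilton2 (A : 'M[R]_2) : A *m A = \tr A *: A - (\det A)%:M.
Proof.
have trE : \tr A = A 0 0 + A 1 1.
  rewrite /mxtrace !big_ord_recl big_ord0 addr0.
  by have -> : lift ord0 ord0 = 1 :> 'I_2 by exact: val_inj.
apply: mx2P; rewrite mulmx2E !mxE trE det2E /=; ring.
Qed.

Lemma rho_symmetric_lin c (A B : 'M[R]_2) :
  rho_symmetric A -> rho_symmetric B -> rho_symmetric (c *: A - B).
Proof. by rewrite !rho_symmetricP !mxE => -> ->; ring. Qed.

(** By Cayley-Hamilton the matrices of v v w and v w w are linear combinations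
    of those of v w and w, resp. of v w and v; so a linear condition that holds
    for v, w and v w is inherited by the two child pairs. *)
Lemma farey_pair_symmetric v w : farey_pair v w ->
  [/\ rho_symmetric (word_mx v), rho_symmetric (word_mx w)
    & rho_symmetric (word_mx (v ++ w))].
Proof.
elim=> {v w} [|v w _ [sv sw svw]|v w _ [sv sw svw]].
- by split; rewrite rho_symmetricP /= !mulmx2E !mxE /=; ring.
- split=> //; rewrite !word_mx_cat mulmxA Cayley_Hamilton2 det_word_mx mulmxBl.
  by rewrite mul1mx -scalemxAl -word_mx_cat; exact: rho_symmetric_lin.
- split=> //; rewrite !word_mx_cat -mulmxA Cayley_Hamilton2 det_word_mx mulmxBr.
  by rewrite mulmx1 -scalemxAr -word_mx_cat; exact: rho_symmetric_lin.
Qed.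

(** Transposing rho V A = (rho V A)^T = A^T (rho V)^T. *)
Lemma rho_intertwine (V A : 'M[R]_2) : rho_symmetric V ->
  rho_symmetric (V *m A) -> A^T *m (rho *m V) = rho *m (V *m A).
Proof. by move=> sV <-; rewrite [rho *m (V *m A)]mulmxA trmx_mul sV. Qed.

(** This locates the left end of the qumterval of w when v and v w are Farey
    words: if f is fixed by g_w, then 1 - g_v(f) is fixed by the composition for
    the reverse complement of w. *)
Lemma inv_branches_reflect v w t :
  rho_symmetric (word_mx v) -> rho_symmetric (word_mx (v ++ w)) ->
  0 < t -> inv_branches v t < 1 ->
  inv_branches (revcompl w) (1 - inv_branches v t) =
    1 - inv_branches (v ++ w) t.
Proof.
move=> sv svw t0 v1; have s0 : 0 < 1 - inv_branches v t by rewrite subr_gt0.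
have [_ d0 ->] := inv_branchesE (revcompl w) s0.
have [_ d1 ->] := inv_branchesE (v ++ w) t0.
move: d0 d1; have [_ d2 ->] := inv_branchesE v t0.
have {sv} := rho_intertwine sv _; rewrite word_mx_revcompl.
move: svw; rewrite word_mx_cat => svw /(_ _ svw).
move: (word_mx v) (word_mx w) d2 => V W d2 /matrixP E.
have := E 0 0; have := E 0 1; have := E 1 0; have := E 1 1.
rewrite !mulmx2E !mxE /= => E11 E10 E01 E00 _.
(* Two columns of one matrix identity, applied to the vector (t, 1). *)
have {}E10 := congr1 ( *%R t) E10; have {}E00 := congr1 ( *%R t) E00.
set n := V 0 0 * t + _ in d2 *; set d := V 1 0 * t + _ in d2 *.
set D := (V 1 0 * _ + _) * t + _; set C := (V 0 0 * _ + _) * t + _ => D0.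
have -> : W 0 1 * (1 - n / d) + W 1 1 = D / d.
  have -> : D = W 0 1 * (d - n) + W 1 1 * d.
    by rewrite /D /d /n; lra.
  by field; lra.
have -> : W 0 0 * (1 - n / d) + W 1 0 = (D - C) / d.
  have -> : D - C = W 0 0 * (d - n) + W 1 0 * d by rewrite /D /C /d /n; lra.
  by field; lra.
by field; lra.
Qed.
End Slow.

(** * Orbits of the endpoints *)

Section Orbit.
Variable R : realType.
Implicit Types (a t x : R) (r : R -> R) (v w q : word).

(** Reduction modulo 1 to the interval of length 1 with right end a.  Nothing is
    required at the ends of the interval, so the condition is stable under the
    reflection of the line, while half-open intervals are not. *)
Definition reduction a r : Prop :=
  (forall y, r (y - 1) = r y) /\ (forall y, a - 1 < y < a -> r y = y).

Definition neg_inv_mod r x : R := r (- x^-1).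

(** Modulo 1, both branches relate to the map x |-> -1/x of x = t - 1: letter 1
    does not change t modulo 1, and letter 0 sends t to 1/(1-t) - 1.  Hence one
    step of neg_inv_mod r runs over one letter 0 and the letters 1 that follow
    it.  For letter 0 the point t - 1 must be in (a-1, a), that is a < t < 1:
    the lower bound is the hypothesis on prefixes, the upper bound follows from
    t < g_0(...). *)
Lemma branches_orbit a r q t : 0 < a < 1 -> reduction a r ->
  a - 1 < t -> t < inv_branches q a ->
  (forall k, (k < size q)%N -> inv_branches (take k q) a < t) ->
  [/\ a - 1 < branches q t < a,
      iter (num0 q) (neg_inv_mod r) (r t) = branches q t
    & mobius (word_mx R q) (branches q t) t].
Proof.
move=> /andP[a0 a1] [rper rid].
elim: q t => [|b q IH] t at1 tq Pq.
  rewrite /= in tq *; split; rewrite ?at1 ?tq ?rid ?at1 ?tq //.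
  by rewrite /mobius !mxE /=; ring.
have ta : a < t by have := Pq 0%N isT.
have qa0 := inv_branches_gt0 q a0.
case: b tq Pq => /= tq Pq.
- have [|||xa it mb] := IH (t - 1).
  + by rewrite ltrD2r.
  + by rewrite ltrBlDr.
  + by move=> k kq; rewrite ltrBrDr; exact: (Pq k.+1).
  split=> //; first by rewrite -it rper.
  have tE : t = inv_branch true (t - 1) by rewrite /= subrK.
  by rewrite [X in mobius _ _ X]tE; apply: mobius_cons.
- have t1 : t < 1 by apply: lt_trans tq _; exact: inv_branch0_lt1.
  have s0 : 0 < t / (1 - t) by rewrite divr_gt0; lra.
  have tE : t = inv_branch false (t / (1 - t)) by rewrite /=; field; lra.
  have [|||xa it mb] := IH (t / (1 - t)).
  + by apply: lt_trans s0; lra.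
  + by rewrite -(ltr_inv_branch false) // -tE.
  + move=> k kq; rewrite -(ltr_inv_branch false) ?inv_branches_gt0 // -tE.
    exact: (Pq k.+1).
  split=> //.
    rewrite /= add0n -iterS iterSr -it; congr (iter _ _ _).
    rewrite /neg_inv_mod -(rper t) (rid (t - 1)); last lra.
    by rewrite -rper; congr (r _); field; lra.
  rewrite [X in mobius _ _ X]tE; apply: mobius_cons => // _; lra.
Qed.

(** The first letter is treated apart, since the orbit starts at the excluded
    end a - 1 of the interval. *)
Lemma farey_orbit v w a r : farey_pair v w -> 0 < a < 1 -> reduction a r ->
  inv_branches v a < a -> a < inv_branches (v ++ w) a ->
  exists x, [/\ a - 1 < x < a,
      iter (num0 (v ++ w)) (neg_inv_mod r) (a - 1) = x
    & mobius (word_mx R (v ++ w)) x a].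
Proof.
move=> vw a01 ra va aw; have /andP[a0 a1] := a01.
have [_ P] := inv_branches_prefix_lt (farey_pair_left vw) a0 va aw.
have [u vE] := farey_pair_head vw; move: aw P; rewrite {}vE /= => aw P.
set q := u ++ w in aw P *.
have s0 : 0 < a / (1 - a) by rewrite divr_gt0; lra.
have aE : a = inv_branch false (a / (1 - a)) by rewrite /=; field; lra.
have qa0 := inv_branches_gt0 q a0.
have [|||xa it mb] := @branches_orbit a r q (a / (1 - a)) a01 ra.
- by apply: lt_trans s0; lra.
- by rewrite -(ltr_inv_branch false) // -aE.
- move=> k kq; rewrite -(ltr_inv_branch false) ?inv_branches_gt0 // -aE.
  exact: (P k.+1).
exists (branches q (a / (1 - a))); split=> //.
  rewrite /= add0n -iterS iterSr -[RHS]it; congr (iter _ _ _).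
  by case: ra => rper _; rewrite /neg_inv_mod -rper; congr (r _); field; lra.
rewrite [X in mobius _ _ X]aE; apply: mobius_cons => // _; lra.
Qed.

Definition reduce a y : R := y - (Num.floor (y + 1 - a))%:~R.

Lemma reduce_sub1 a y : reduce a (y - 1) = reduce a y.
Proof.
rewrite /reduce; have -> : y - 1 + 1 - a = y + 1 - a - 1 by ring.
rewrite floorDrz ?rpredN ?rpred1 // floorN ?rpred1 // floor1 intrD.
by rewrite rmorphN1; ring.
Qed.

Lemma reduce_id a y : a - 1 < y < a -> reduce a y = y.
Proof.
move=> ya; rewrite /reduce (_ : Num.floor _ = 0) ?subr0 //.
by apply: floor_def; rewrite /=; lra.
Qed.

Lemma reduction_reduce a : reduction a (reduce a).
Proof. by split=> y; [exact: reduce_sub1|exact: reduce_id]. Qed.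

Lemma reduction_reduceN a : reduction (1 - a) (fun y => - reduce a (- y)).
Proof.
split=> y; first by rewrite -[in LHS]reduce_sub1; congr (- reduce _ _); ring.
by move=> ya; rewrite reduce_id ?opprK //; lra.
Qed.

(** The convention 1/0 = 0 makes the exceptional value at 0 an instance of the
    general formula. *)
Lemma K_reduce a : 0 < a < 1 -> K a =1 neg_inv_mod (reduce a).
Proof.
move=> a01 x; rewrite /K /neg_inv_mod; case: eqP => [->|//].
by rewrite invr0 oppr0 reduce_id //; lra.
Qed.

(** Let g and h be the inverse compositions of v w and of its reverse
    complement, and s = 1 - g_v(a).  The reflection identity turns a < g(a) into
    h(s) < s, while 1 - a < h(1 - a); therefore 1 - a < s. *)
Lemma inv_branches_left_lt v w a : farey_pair v w -> 0 < a < 1 ->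
  a < inv_branches (v ++ w) a ->
  1 - a < inv_branches (revcompl (v ++ w)) (1 - a) -> inv_branches v a < a.
Proof.
move=> vw /andP[a0 a1] aw hw.
have v1 : inv_branches v a < 1.
  have [u ->] := farey_pair_head vw.
  by rewrite inv_branch0_lt1 ?inv_branches_gt0.
have [sv _ svw] := farey_pair_symmetric R vw.
have [_ _ svvw] := farey_pair_symmetric R (farey_pair_left vw).
have e := inv_branches_reflect sv svvw a0 v1.
suff : 1 - a < 1 - inv_branches v a by lra.
apply: (inv_branches_above_below _ _ hw); [lra|lra|].
by rewrite e inv_branches_cat ltrD2l ltrN2 ltr_inv_branches // inv_branches_gt0.
Qed.

(** Symmetry of rho times the matrix says exactly that the two end points
    x and y = - x' satisfy y = x / (1 + x), that is -1/y = -1/x - 1. *)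
Lemma mobius_matching w a x x' : rho_symmetric (word_mx R w) ->
  mobius (word_mx R w) x a ->
  mobius (word_mx R (revcompl w)) x' (1 - a) ->
  - x' * (1 + x) = x.
Proof.
rewrite rho_symmetricP word_mx_revcompl /mobius !mxE => s.
have := det_word_mx R w; rewrite det2E s.
move: (word_mx R w 0 0) (word_mx R w 0 1) (word_mx R w 1 0) => P Q S d e e'.
have c0 : P - S * a != 0.
  apply/eqP => c; suff : 0 = 1 :> R by move/eqP; rewrite eq_sym oner_eq0.
  rewrite -d; have aQ : a * (Q + S) = Q by nra.
  have -> : P = S * a by lra.
  by rewrite -mulrA aQ; ring.
apply: (mulIf c0).
have e1 : (1 + x) * (P - S * a) = P - Q * (1 - a) by lra.
have e2 : x' * (P - Q * (1 - a)) = - x * (P - S * a) by lra.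
by rewrite -mulrA e1 mulNr e2; ring.
Qed.

(** One endpoint orbit is that of a - 1 under K a; reflected in 0, the other is
    an orbit of the same kind for 1 - a and the reverse complement.  They reach
    x and y with -1/x and -1/y congruent modulo 1. *)
Lemma matching v w a : farey_pair v w -> 0 < a < 1 ->
  a < inv_branches (v ++ w) a ->
  1 - a < inv_branches (revcompl (v ++ w)) (1 - a) ->
  iter (num0 (v ++ w)).+1 (K a) (a - 1) = iter (num1 (v ++ w)).+1 (K a) a.
Proof.
move=> vw a01 aw hw; have va := inv_branches_left_lt vw a01 aw hw.
have a01' : 0 < 1 - a < 1 by lra.
have hv : inv_branches (revcompl w) (1 - a) < 1 - a.
  apply: (inv_branches_left_lt (farey_pair_revcompl vw) a01');
    rewrite -revcompl_cat //.
  by rewrite revcomplK opprB addrC subrK.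
rewrite revcompl_cat in hw.
have [x [xa itx mx]] := farey_orbit vw a01 (reduction_reduce a) va aw.
have [x' [xa' itx' mx']] :=
  farey_orbit (farey_pair_revcompl vw) a01' (reduction_reduceN a) hv hw.
rewrite -revcompl_cat in itx' mx'.
have [_ _ svw] := farey_pair_symmetric R vw.
have m : - x' * (1 + x) = x by exact: mobius_matching svw mx mx'.
have iterK n y : iter n (K a) y = iter n (neg_inv_mod (reduce a)) y.
  by apply: eq_iter; exact: K_reduce.
have ity : iter (num1 (v ++ w)) (K a) a = - x'.
  rewrite iterK -itx' num0_revcompl.
  have -> : 1 - a - 1 = - a by ring.
  elim: (num1 _) => [|n IH] /=; first by rewrite opprK.
  by rewrite IH /neg_inv_mod opprK invrN opprK.
rewrite /= ity iterK itx !K_reduce // /neg_inv_mod.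
have [x0|x0] := eqVneq x 0.
  by move: m; rewrite x0 addr0 mulr1 => ->.
rewrite -reduce_sub1; congr reduce; move: m xa.
have [->|x'0 m xa] := eqVneq x' 0; first by rewrite oppr0 mul0r; lra.
have -> : - x^-1 - 1 = - ((1 + x) / x) by field.
by rewrite -[X in _ / X]m; field; rewrite x'0 /=; lra.
Qed.
End Orbit.

(** * Periodic continued fractions *)

Section ContinuedFractions.
Variable R : realType.
Implicit Types (t x y f : R) (s S : seq nat) (w : word).

Definition cf_step (k : nat) x : R := (k%:R + x)^-1.

Lemma RL_neq0 b w : exists k ks, RL (b :: w) = k.+1 :: ks.
Proof.
rewrite /=; case: (RL w) => [|k ks]; first by exists 0%N, [::].
by case: ifP => _; [exists k, ks|exists 0%N, (k :: ks)].
Qed.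

Lemma RL_cons b c w : RL (b :: c :: w) =
  if b == c then (head 0%N (RL (c :: w))).+1 :: behead (RL (c :: w))
  else 1%N :: RL (c :: w).
Proof.
have [k [ks E]] := RL_neq0 c w.
change (RL (b :: c :: w)) with
  (if RL (c :: w) is k :: ks
   then if Some c == Some b then k.+1 :: ks else 1%N :: k :: ks else [:: 1%N]).
by rewrite E (inj_eq Some_inj) eq_sym.
Qed.

Lemma RL_gt0 w : all (ltn 0) (RL w).
Proof.
elim: w => //= b w; case: (RL w) => //= k ks /andP[k0 ks0].
by case: ifP => _ /=; rewrite ks0 ?k0.
Qed.

Lemma foldr_cf_gt0 s t : all (ltn 0) s -> 0 < t -> 0 < foldr cf_step t s.
Proof.
move=> + t0; elim: s => //= k s IH /andP[k0 /IH s0].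
by rewrite invr_gt0 addr_gt0 // ltr0n.
Qed.

(** A block of k equal letters is t |-> 1/(k + 1/t) or t |-> k + t; for a word
    ending in 1 these compose to a continued fraction, with an extra inversion
    when the word starts with 1. *)
Lemma inv_branches_RL w t : 0 < t -> last false w ->
  foldr cf_step t (RL w) =
    if head false w then (inv_branches w t)^-1 else inv_branches w t.
Proof.
move=> t0; elim: w => // b [|c w IH lw].
  by case: b => //= _; rewrite /cf_step addrC.
have {lw}/IH : last false (c :: w) := lw.
have := inv_branches_gt0 (c :: w) t0; rewrite -/(inv_branches (c :: w) t).
have := RL_gt0 (c :: w).
have [k [ks E]] := RL_neq0 c w; rewrite RL_cons E.
have -> : inv_branches (b :: c :: w) t =
    inv_branch b (inv_branches (c :: w) t) by [].
move: (inv_branches (c :: w) t) => X /=; move=> ks0 X0.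
have Y0 := foldr_cf_gt0 ks0 t0; rewrite {ks0}.
have z0 : 0 < k.+1%:R + foldr cf_step t ks by rewrite addr_gt0 // ltr0n.
have zS : cf_step k.+2 (foldr cf_step t ks) =
    (k.+1%:R + foldr cf_step t ks + 1)^-1.
  by rewrite /cf_step -[k.+2%:R]natr1 addrAC.
have zE : cf_step k.+1 (foldr cf_step t ks) = (k.+1%:R + foldr cf_step t ks)^-1.
  by [].
case: b; case: c {E} => /=; rewrite ?zS zE;
  move: (k.+1%:R + _) z0 => z z0; rewrite /cf_step {zS zE}.
- by move/invr_inj => ->.
- by move=> <-; rewrite addrC.
- by move/invr_inj => ->; field; lra.
- by move=> <-; field; lra.
Qed.

(** Reading the blocks backwards with the letters exchanged; t stands for the
    part already read, inverted when the current block is one of 1s. *)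
Lemma inv_branches_rev_RL b w t : 0 < t -> last b w ->
  foldr cf_step (if b then t^-1 else t) (rev (RL (b :: w))) =
    inv_branches (revcompl (b :: w)) t.
Proof.
rewrite -foldl_rev revK => t0.
have revcomplE c u x : inv_branches (revcompl (c :: u)) x =
    inv_branches (revcompl u) (inv_branch (~~ c) x).
  by rewrite -cat1s revcompl_cat inv_branches_cat.
elim: w b t t0 => [|c w IH] b t t0 lw.
  by case: b lw => //= _; rewrite addrC; field; lra.
have IHt := IH c (inv_branch (~~ b) t) (inv_branch_gt0 _ t0) lw.
rewrite revcomplE -IHt RL_cons; have [k [ks ->]] := RL_neq0 c w.
case: b {IHt lw}; case: c => /=; congr (foldl _ _ ks);
  rewrite /cf_step -?[k.+2%:R]natr1; congr (_ ^-1).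
- by field; lra.
- have -> : 1 + t^-1 = (1 + t) / t.
    by field; lra.
  by rewrite invf_div.
- by rewrite [1 + t]addrC.
- by ring.
Qed.

(** Two consecutive steps x |-> 1/(k + 1/(l + x)) divide distances by at least 4.
    A single step need not contract, so the induction carries the bound for s
    and for k :: s together. *)
Lemma foldr_cf_contracts s x y : all (ltn 0) s -> 0 <= x -> 0 <= y ->
  `|foldr cf_step x s - foldr cf_step y s| <= 2 * 2^-1 ^+ size s * `|x - y|.
Proof.
move=> + x0 y0.
have pos u t : 0 <= t -> 0 <= foldr cf_step t u.
  move=> t0; elim: u => //= k u IH.
  by rewrite invr_ge0 addr_ge0.
suff : (all (ltn 0) s -> `|foldr cf_step x s - foldr cf_step y s|
          <= 2 * 2^-1 ^+ size s * `|x - y|) /\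
       forall k, all (ltn 0) (k :: s) ->
         `|foldr cf_step x (k :: s) - foldr cf_step y (k :: s)|
          <= 2 * 2^-1 ^+ (size s).+1 * `|x - y| by case.
elim: s => [|l s [IHs IH]].
  split=> [_|k]; first by rewrite expr0 mulr1 ler_peMl //; lra.
  rewrite /= andbT /cf_step expr1 divff ?mul1r // => k0.
  have k1 : 1 <= k%:R :> R by rewrite ler1n.
  have -> : (k%:R + x)^-1 - (k%:R + y)^-1 = (y - x) / ((k%:R + x) * (k%:R + y)).
    by field; rewrite !gt_eqF //; lra.
  rewrite normrM distrC normfV ler_piMr // invf_le1 ger0_norm; nra.
split=> [|k]; first exact: IH.
rewrite [all _ _]/= => /andP[k0 lp]; have /andP[l0 sp] := lp.
have := IHs sp; rewrite /=.
move: (foldr cf_step x s) (foldr cf_step y s) (pos s _ x0) (pos s _ y0).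
move=> X Y X0 Y0 XY.
have k1 : 1 <= k%:R :> R by rewrite ler1n.
have l1 : 1 <= l%:R :> R by rewrite ler1n.
rewrite /cf_step; set u := l%:R + X; set v := l%:R + Y.
have u1 : 1 <= u by rewrite /u; lra.
have v1 : 1 <= v by rewrite /v; lra.
have -> : (k%:R + u^-1)^-1 - (k%:R + v^-1)^-1 =
    (X - Y) / ((k%:R * u + 1) * (k%:R * v + 1)).
  rewrite (_ : X - Y = u - v); last by rewrite /u /v; ring.
  by field; rewrite !gt_eqF //; nra.
rewrite normrM normfV (le_trans (y := `|X - Y| / 4)) //.
  have d4 : 2 * 2 <= (k%:R * u + 1) * (k%:R * v + 1).
    by apply: ler_pM => //; nra.
  by rewrite ler_wpM2l // ger0_norm ?lef_pV2 ?posrE //; lra.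
rewrite ler_pdivrMr // (le_trans XY) //.
by rewrite le_eqVlt !exprS; apply/predU1P; left; field.
Qed.

(** The convergents are values at 0 of the same compositions whose value at the
    n-th tail is f, so they approach f by contraction. *)
Lemma periodic_cfrac_fixed S f : S != [::] -> all (ltn 0) S -> 0 < f ->
  foldr cf_step f S = f -> periodic_cfrac R S = f.
Proof.
move=> S0 Spos f0 fS; have nS : (0 < size S)%N by rewrite lt0n size_eq0.
set d := fun i => nth 0%N S (i %% size S).
pose tail i := foldr cf_step f (drop (i %% size S) S).
have tail_gt0 i : 0 < tail i.
  by apply: foldr_cf_gt0 => //; apply/allP => k /mem_drop; exact/allP.
have tailS i : tail i = cf_step (d i) (tail i.+1).
  rewrite /tail /d (drop_nth 0%N) ?ltn_mod //=; congr cf_step.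
  have : (i %% size S < size S)%N by rewrite ltn_mod.
  rewrite leq_eqVlt -[i.+1]addn1 -modnDml addn1.
  case/predU1P => [e|lt]; last by rewrite (modn_small lt).
  by rewrite e modnn drop_size drop0 fS.
have d_gt0 n : all (ltn 0) (mkseq d n).
  apply/allP => _ /mapP[i _ ->]; rewrite /= /d.
  by move/allP: Spos; apply; rewrite mem_nth // ltn_mod.
have tail_le1 i : tail i <= 1.
  have : 1 <= (d i)%:R :> R.
    have /allP := d_gt0 i.+1; rewrite ler1n; apply.
    by rewrite mkseqS mem_rcons mem_head.
  by move=> di; rewrite tailS /cf_step invf_le1; have := tail_gt0 i.+1; lra.
have unroll n : f = foldr cf_step (tail n) (mkseq d n).
  elim: n => [|n IH]; first by rewrite /tail mod0n drop0.
  by rewrite mkseqS foldr_rcons -tailS.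
apply: cvg_lim; first exact: Rhausdorff.
apply/subr_cvg0; apply: norm_cvg0.
apply: (@squeeze_cvgr _ _ _ _ (fun=> 0) (geometric 2 2^-1)).
- apply: nearW => n; rewrite normr_ge0 /=.
  have := foldr_cf_contracts (d_gt0 n) (lexx 0) (ltW (tail_gt0 n)).
  rewrite -unroll size_mkseq => /le_trans; apply; rewrite ler_piMr //.
  by rewrite sub0r normrN ger0_norm // ltW.
- exact: cvg_cst.
- by apply: cvg_geometric; rewrite ger0_norm ?invf_lt1 ?invr_ge0 // ltr1n.
Qed.

Lemma word_mx_ge0 w : let A := word_mx R w in
  [/\ 0 < A 0 0, 0 <= A 0 1, 0 <= A 1 0 & 0 < A 1 1].
Proof.
elim: w => [|b w [p q r s]] /=; first by rewrite !mxE /=; split.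
by rewrite !mulmx2E !mxE /=; case: b => /=; split; lra.
Qed.

Lemma word_mx10_gt0 w : 0 < word_mx R (false :: w) 1 0.
Proof.
have [p _ r _] := word_mx_ge0 w; rewrite /= mulmx2E !mxE /=; lra.
Qed.

Lemma inv_branches_fixed w : 0 < word_mx R w 0 1 -> 0 < word_mx R w 1 0 ->
  exists2 f : R, 0 < f & inv_branches w f = f.
Proof.
have := @inv_branchesE R w; move: (word_mx R w) => A wE q r.
pose b := A 0 0 - A 1 1; pose D := b ^+ 2 + 4 * A 0 1 * A 1 0.
have qr : 0 < A 0 1 * A 1 0 by rewrite mulr_gt0.
have D0 : 0 <= D by rewrite /D; nra.
have sD : `|b| < Num.sqrt D.
  by rewrite -sqrtr_sqr ltr_sqrt /D ?ltrDl -?mulrA; nra.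
have sDE := sqr_sqrtr D0; move: sD sDE; move: (Num.sqrt D) => u sD uE.
have bu : 0 < b + u by move: sD; rewrite ltr_norml; lra.
(* The positive root of A10 f^2 - b f - A01 = 0. *)
exists ((b + u) / (2 * A 1 0)); first by rewrite divr_gt0 // mulr_gt0.
have f0 : 0 < (b + u) / (2 * A 1 0) by rewrite divr_gt0 // mulr_gt0.
have [_ d0 ->] := wE _ f0; rewrite -[RHS](mulfK (lt0r_neq0 d0)); congr (_ / _).
apply/eqP; rewrite eq_sym -subr_eq0; apply/eqP.
transitivity ((u ^+ 2 - D) / (4 * A 1 0)); last by rewrite uE subrr mul0r.
by rewrite /D /b; field; lra.
Qed.

(** The right end of the qumterval is the fixed point of w, and 1 minus the left
    end is that of its reverse complement. *)
Lemma qumterval_pair v w a : farey_pair v w ->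
  a \in qumterval R (v ++ w) ->
  [/\ 0 < a < 1, a < inv_branches (v ++ w) a
    & 1 - a < inv_branches (revcompl (v ++ w)) (1 - a)].
Proof.
move=> vw; have [u vE] := farey_pair_head vw.
have [u' wE] := farey_pair_last vw.
have [y yE] := farey_pair_head (farey_pair_revcompl vw).
set W := v ++ w.
have WE : W = false :: (u ++ w) by rewrite /W vE.
have lW b : last b W by rewrite /W last_cat wE last_rcons.
have hE : revcompl W = false :: (y ++ revcompl v) by rewrite revcompl_cat yE.
have q0 : 0 < word_mx R W 0 1.
  by have := word_mx10_gt0 (y ++ revcompl v); rewrite -hE word_mx_revcompl mxE.
have r0 : 0 < word_mx R W 1 0 by rewrite WE word_mx10_gt0.
have RL0 : RL W != [::].
  by rewrite WE; have [k [ks ->]] := RL_neq0 false (u ++ w).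
have [f f0 fW] := inv_branches_fixed q0 r0.
have [f' f'0 f'W] : exists2 f : R, 0 < f & inv_branches (revcompl W) f = f.
  by apply: inv_branches_fixed; rewrite word_mx_revcompl mxE.
have -> : qumterval R W = `]1 - f', f[.
  have eW : periodic_cfrac R (RL W) = f.
    apply: periodic_cfrac_fixed; rewrite ?RL_gt0 // inv_branches_RL ?lW // fW.
    by rewrite WE.
  have eW' : periodic_cfrac R (rev (RL W)) = f'.
    apply: periodic_cfrac_fixed; rewrite ?all_rev ?RL_gt0 //.
      by rewrite -size_eq0 size_rev size_eq0.
    have := @inv_branches_rev_RL false (u ++ w) f' f'0.
    by rewrite -WE f'W => -> //; have := lW false; rewrite WE.
  by rewrite /qumterval eW eW'.
rewrite in_itv /= => /andP[fa af].
have f1 : f < 1 by rewrite -fW WE inv_branch0_lt1 // inv_branches_gt0.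
have f'1 : f' < 1 by rewrite -f'W hE inv_branch0_lt1 // inv_branches_gt0.
split; first lra.
  by apply: (inv_branches_fixed_gt _ _ af fW); rewrite ?WE //; lra.
by apply: (inv_branches_fixed_gt _ _ _ f'W); rewrite ?hE //; lra.
Qed.
End ContinuedFractions.

Theorem corollary4p2 (R : realType) (w : word)
    (hw : nondegenerate_farey_word w)
    (alpha : R) (halpha : alpha \in qumterval R w) :
  iter (num0 w).+1 (K alpha) (alpha - 1) = iter (num1 w).+1 (K alpha) alpha.
Proof.
have [u [v [uv wE]]] := nondegenerate_farey_pair hw.
rewrite wE in halpha *; have [a01 lt1 lt2] := qumterval_pair uv halpha.
exact: matching.
Qed.
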